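(* Let $\mathscr C$ be an extension closed variety of finite groups. Let $F$ be a free pro-$\mathscr C$ group on a pointed profinite space $(X,\ast)$ and let $H$ be an open subgroup of $F$. Then $H$ is a free pro-$\mathscr C$ group on a pointed profinite space.
   Context: A variety of finite groups is a nonempty class $\mathscr C$ of finite groups closed under taking subgroups, finite direct products and homomorphic images; it is extension closed if it is moreover closed under extensions of groups. A pro-$\mathscr C$ group is a profinite group whose continuous finite quotients are in $\mathscr C$, i.e. an inverse limit of groups in $\mathscr C$. A profinite space is a compact Hausdorff totally disconnected topological space; a pointed profinite space $(X,\ast)$ is a profinite space with a distinguished point $\ast\in X$. The distinguished point of a group is its identity element, and maps of pointed spaces send distinguished point to distinguished point. A pro-$\mathscr C$ group $F$ is a free pro-$\mathscr C$ group on the pointed profinite space $(X,\ast)$ if there is a continuous map of pointed spaces $\iota\colon X\to F$ such that for every continuous map of pointed spaces $\sigma\colon X\to G$ into a pro-$\mathscr C$ group $G$ there is a unique continuous homomorphism $\psi\colon F\to G$ with $\psi\iota=\sigma$. *)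

(* Defs.v *)
From HB Require Import structures.
From mathcomp Require Import all_boot all_order all_algebra all_fingroup.
From mathcomp Require Import all_classical topology.

Set Implicit Arguments.
Unset Strict Implicit.
Unset Printing Implicit Defensive.

Local Open Scope classical_set_scope.
Local Open Scope group_scope.

(* Unqualified, [Group] is the constructor of {group gT}; [monoid.Group] is the
   class of (possibly infinite) groups. *)

HB.mixin Record isTopologicalGroup G & Topological G & monoid.Group G := {
  mulg_continuous : continuous (fun x : G * G => x.1 * x.2) ;
  invg_continuous : continuous (fun x : G => x^-1)
}.

#[short(type="topologicalGroupType")]
HB.structure Definition TopologicalGroup :=
  {G of isTopologicalGroup G & Topological G & monoid.Group G}.

(* [groupClosed G] is the type of subgroups of [G], as boolean predicates on [G]
   (classically, any subset is one). *)
Definition subgroup_type (G : groupType) (H : groupClosed G) : Type :=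
  {x : G | x \in H}.

Section SubgroupType.
Context (G : groupType) (H : groupClosed G).

Lemma subgroup_closed : group_closed (fun x => x \in H).
Proof. by split=> [|x y xH yH]; [exact: gpred1 | exact: gpredF]. Qed.

HB.instance Definition _ := SubChoice.on (subgroup_type H).
HB.instance Definition _ := SubChoice_isSubGroup.Build
  G (fun x => x \in H) (subgroup_type H) subgroup_closed.

End SubgroupType.

Section SubgroupTopology.
Context (G : topologicalGroupType) (H : groupClosed G).

HB.instance Definition _ := Topological.copy (subgroup_type H)
  (initial_topology (val : subgroup_type H -> G)).

Let sval_continuous : continuous (val : subgroup_type H -> G).
Proof. exact: initial_continuous. Qed.

Lemma subgroup_mulg_continuous :
  continuous (fun x : subgroup_type H * subgroup_type H => x.1 * x.2).
Proof.
apply: continuous_comp_initial => x.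
have -> : (val : subgroup_type H -> G) \o (fun x => x.1 * x.2) =
    (fun x : G * G => x.1 * x.2) \o (fun x => (val x.1, val x.2)) by [].
apply: continuous_comp; last exact: mulg_continuous.
apply: cvg_pair.
  by apply: continuous_comp; [exact: cvg_fst | exact: sval_continuous].
by apply: continuous_comp; [exact: cvg_snd | exact: sval_continuous].
Qed.

Lemma subgroup_invg_continuous : continuous (fun x : subgroup_type H => x^-1).
Proof.
apply: continuous_comp_initial => x.
have -> : (val : subgroup_type H -> G) \o (fun x => x^-1) =
    (fun x : G => x^-1) \o val by [].
by apply: continuous_comp; [exact: sval_continuous | exact: invg_continuous].
Qed.

HB.instance Definition _ := isTopologicalGroup.Build (subgroup_type H)
  subgroup_mulg_continuous subgroup_invg_continuous.

End SubgroupTopology.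

(* Closure under isomorphism, and independence of the ambient type [gT], are
   instances of [variety_hom]. *)
Record is_variety (C : forall gT : finGroupType, {group gT} -> Prop) : Prop := {
  variety_nonempty : exists (gT : finGroupType) (G : {group gT}), C gT G ;
  variety_sub : forall (gT : finGroupType) (G H : {group gT}),
    H \subset G -> C gT G -> C gT H ;
  variety_prod : forall (I : finType) (gT : I -> finGroupType)
      (G : forall i, {group gT i}),
    (forall i, C (gT i) (G i)) -> C _ (setXn_group G) ;
  variety_hom : forall (gT rT : finGroupType) (G : {group gT})
      (f : {morphism G >-> rT}),
    C gT G -> C rT (f @* G)%G
}.

Definition is_extension_closed_variety
    (C : forall gT : finGroupType, {group gT} -> Prop) : Prop :=
  is_variety C /\
  forall (gT : finGroupType) (G N : {group gT}),
    N <| G -> C gT N -> C _ (G / N)%G -> C gT G.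

Definition profinite_space (X : topologicalType) : Prop :=
  [/\ compact [set: X], hausdorff_space X & totally_disconnected [set: X]].

Definition continuous_hom (G K : topologicalGroupType) (f : G -> K) : Prop :=
  continuous f /\ {morph f : x y / x * y}.

(* The continuous finite quotients of [G] are its images under continuous
   homomorphisms onto finite groups with the discrete topology. *)
Definition pro_group (C : forall gT : finGroupType, {group gT} -> Prop)
    (G : topologicalGroupType) : Prop :=
  profinite_space G /\
  forall (gT : finGroupType) (f : G -> gT),
    continuous (f : G -> discrete_topology gT) ->
    {morph f : x y / x * y} ->
    (forall y, exists x, f x = y) ->
    C gT [set: gT]%G.

Definition free_pro_group (C : forall gT : finGroupType, {group gT} -> Prop)
    (X : topologicalType) (x0 : X) (F : topologicalGroupType) : Prop :=
  pro_group C F /\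
  exists iota : X -> F,
    [/\ continuous iota, iota x0 = 1 &
      forall (G : topologicalGroupType) (sigma : X -> G),
        pro_group C G -> continuous sigma -> sigma x0 = 1 ->
        exists! psi : F -> G, continuous_hom psi /\ psi \o iota = sigma].

Arguments free_pro_group C X x0 F : clear implicits.

(* Main.v *)
Require Import Defs.
From HB Require Import structures.
From mathcomp Require Import all_boot all_fingroup all_classical topology.

(** Let [F] be free pro-C on [iota : X -> F] and [H] open in [F]. The set [S] of
right cosets of [H] is finite, [F] acts on it on the right, and [H] is the
stabilizer of the base point [s0]. As in the discrete theory, one picks a
Schreier transversal [t : S -> F] and the Schreier generators
[t s * iota x * (t (s x))^-1] of [H]; the claim is that [H] is free on them.

The transversal. The positive words in [iota x] already move [s0] to every point
of [S] ([free_action_connect]): the permutations preserving the set of reachable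
points form a subgroup of the finite image of [F], a group of the variety that
contains the images of all [iota x], so the universal property of [F] puts the
whole image of [F] in it. A tree of shortest positive words then gives [t]
([schreier_transversal]).

The basis. It is the set of all Schreier generators, as a subspace of [H],
pointed by [1]. It is the continuous image of the compact space [S * X] in [H],
hence a profinite space.

The universal property. For a pro-C group [K], maps [c : S -> F -> K] that are
continuous in [F] and satisfy [c s (g * h) = c s g * c (s g) h] are exactly the
lifts of the action of [F] on [S] to continuous homomorphisms from [F] to the
wreath product [K wr Q], where [Q] is the image of [F] in the permutations of
[S]. The wreath product is pro-C because C is extension closed
([pro_group_wreath]), so freeness of [F] says that such a cocycle exists and is
unique for prescribed values at the [iota x] ([free_cocycle_exists],
[free_cocycle_unique]).
- Existence. A map [sigma] on the Schreier generators prescribes the values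
  [sigma (t s * iota x * (t (s x))^-1)]; let [d] be the cocycle that takes them.
  Since [H] fixes [s0], the map [h |-> d s0 h] is a homomorphism on [H].
  The generators along the edges of the tree are trivial, hence
  [d s0 (t s) = 1] for all [s], and [d s0] extends [sigma].
- Uniqueness. If [psi : H -> K] is a homomorphism, then
  [psi (t s * g * (t (s g))^-1)] is a cocycle, determined by its values at the
  [iota x], that is by [psi] on the Schreier generators, and it gives [psi] back
  at [s0].

That [H] is pro-C is [pro_group_open_subgroup]. *)

Set Implicit Arguments.
Unset Strict Implicit.
Unset Printing Implicit Defensive.

Local Open Scope classical_set_scope.
Local Open Scope group_scope.

(** * Continuous maps and discrete groups *)

Lemma morph1 (G K : groupType) (f : G -> K) :
  {morph f : x y / x * y} -> f 1 = 1.
Proof. by move=> fM; apply: (mulgI (f 1)); rewrite -fM !mulg1. Qed.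

Lemma discrete_continuous (T : discreteTopologicalType) (U : topologicalType)
  (f : T -> U) : continuous f.
Proof. by apply/continuousP => A _; exact: discrete_open. Qed.

HB.instance Definition _ (Q : groupType) :=
  monoid.Group.copy (discrete_topology Q) Q.

Lemma discrete_mulg_continuous (Q : groupType) :
  continuous (fun x : discrete_topology Q * discrete_topology Q => x.1 * x.2).
Proof.
move=> [a b] U /principal_filterP Uab.
exists ([set a], [set b]); first by split; exact: discrete_set1.
by move=> [x y] [/= -> ->].
Qed.

HB.instance Definition _ (Q : groupType) :=
  isTopologicalGroup.Build (discrete_topology Q)
    (@discrete_mulg_continuous Q)
    (@discrete_continuous (discrete_topology Q) _ _).

Lemma prod_topology_continuous (T : topologicalType) (I : Type)
    (U : I -> topologicalType) (f : T -> prod_topology U) :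
  (forall i, continuous (fun x => f x i)) -> continuous f.
Proof.
move=> cf x; apply/cvg_sup => i V [_ [[A oA <-] Afx] sAV].
by apply: filterS sAV _; apply: cf; exact: open_nbhs_nbhs.
Qed.

Lemma pair_continuous (T U V : topologicalType) (f : T -> U) (g : T -> V) :
  continuous f -> continuous g -> continuous (fun x => (f x, g x)).
Proof. by move=> cf cg x; apply: cvg_pair; [exact: cf | exact: cg]. Qed.

Lemma fst_continuous (T U : topologicalType) : continuous (@fst T U).
Proof. by move=> x; exact: cvg_fst. Qed.

Lemma snd_continuous (T U : topologicalType) : continuous (@snd T U).
Proof. by move=> x; exact: cvg_snd. Qed.

Lemma comp_continuous (T U V : topologicalType) (f : T -> U) (g : U -> V) :
  continuous f -> continuous g -> continuous (g \o f).
Proof. by move=> cf cg x; apply: continuous_comp; [exact: cf | exact: cg]. Qed.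

Lemma mul_fun_continuous (T : topologicalType) (G : topologicalGroupType)
    (f g : T -> G) :
  continuous f -> continuous g -> continuous (fun x => f x * g x).
Proof.
move=> cf cg.
exact: (comp_continuous (pair_continuous cf cg) (@mulg_continuous G)).
Qed.

Lemma inv_fun_continuous (T : topologicalType) (G : topologicalGroupType)
    (f : T -> G) :
  continuous f -> continuous (fun x => (f x)^-1).
Proof. by move=> cf; exact: (comp_continuous cf (@invg_continuous G)). Qed.

(** A discrete valued [j] is locally constant, so that near any point only one
of the maps [f d] is involved. *)
Lemma eval_continuous (T V : topologicalType) (D : discreteTopologicalType)
    (f : D -> T -> V) (j : T -> D) :
  (forall d, continuous (f d)) -> continuous j ->
  continuous (fun x => f (j x) x).
Proof.
move=> cf cj x U Ux.
have jx : nbhs x (j @^-1` [set j x]) by apply: cj; exact: discrete_set1.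
have fx : nbhs x (f (j x) @^-1` U) by apply: cf.
by apply: filterS2 jx fx => y /= ->.
Qed.

(** * Permutational wreath products *)

(** The group law depends on [to], which is an argument of the type for the
law to be found by unification. *)
Definition wreath_type (K : Type) (Q : finGroupType) (I : finType)
    of {action Q &-> I} : Type :=
  (prod_topology (fun _ : I => K) * discrete_topology Q)%type.

Section Wreath.
Context (K : topologicalGroupType) (Q : finGroupType) (I : finType).
Context (to : {action Q &-> I}).
Local Notation wreath := (wreath_type K to).

HB.instance Definition _ := Topological.copy wreath
  (prod_topology (fun _ : I => K) * discrete_topology Q)%type.

Implicit Types u v w : wreath.

(** The law makes [(a, q)] send [i] to [to i q] and collect [a i] on the way:
the [i]-th coordinate of a product is the product of the coordinates met along
the path that starts at [i]. *)
Definition wreath_mul u v : wreath :=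
  (fun i => u.1 i * v.1 (to i u.2), u.2 * v.2).
Definition wreath_one : wreath := (fun=> 1, 1).
Definition wreath_inv u : wreath :=
  (fun i => (u.1 (to i u.2^-1))^-1, u.2^-1).

Lemma wreath_eq u v : u.1 =1 v.1 -> u.2 = v.2 -> u = v.
Proof. by case: u v => [a p] [b q] /= /funext -> ->. Qed.

Lemma wreath_mulA : associative wreath_mul.
Proof.
move=> u v w; apply: wreath_eq => [i|] /=; last exact: mulgA.
by rewrite actM mulgA.
Qed.

Lemma wreath_mul1 : left_id wreath_one wreath_mul.
Proof.
by move=> u; apply: wreath_eq => [i|] /=; rewrite ?act1 mul1g.
Qed.

Lemma wreath_mul1r : right_id wreath_one wreath_mul.
Proof.
by move=> u; apply: wreath_eq => [i|] /=; rewrite mulg1.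
Qed.

Lemma wreath_mulV : left_inverse wreath_one wreath_inv wreath_mul.
Proof.
by move=> u; apply: wreath_eq => [i|] /=; rewrite mulVg.
Qed.

Lemma wreath_mulVr : right_inverse wreath_one wreath_inv wreath_mul.
Proof.
by move=> u; apply: wreath_eq => [i|] /=; rewrite ?actK mulgV.
Qed.

HB.instance Definition _ :=
  monoid.isGroup.Build wreath wreath_mulA wreath_mul1 wreath_mul1r
    wreath_mulV wreath_mulVr.

Lemma wreath_base_continuous i : continuous (fun u : wreath => u.1 i).
Proof.
exact: (@comp_continuous _ (prod_topology (fun=> K)) _ _ (fun f => f i)
  (@fst_continuous _ _) (@proj_continuous I (fun=> K) i)).
Qed.

Lemma wreath_top_continuous : continuous (fun u : wreath => u.2).
Proof. exact: snd_continuous. Qed.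

Lemma wreath_continuous (T : topologicalType) (f : T -> wreath) :
    (forall i, continuous (fun x => (f x).1 i)) ->
    continuous (fun x => (f x).2) ->
  continuous f.
Proof.
move=> cf cq.
rewrite (_ : f = fun x => ((f x).1, (f x).2)); last first.
  by apply/funext => x; case: (f x).
by apply: pair_continuous => //; exact: prod_topology_continuous.
Qed.

Lemma wreath_mulg_continuous :
  continuous (fun x : wreath * wreath => x.1 * x.2).
Proof.
have c1 : continuous (@fst wreath wreath) by exact: fst_continuous.
have c2 : continuous (@snd wreath wreath) by exact: snd_continuous.
have c12 := comp_continuous c1 wreath_top_continuous.
apply: wreath_continuous => [i|]; last first.
  exact: (mul_fun_continuous c12 (comp_continuous c2 wreath_top_continuous)).
have c11 := comp_continuous c1 (@wreath_base_continuous i).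
apply: (mul_fun_continuous c11).
apply: (@eval_continuous _ _ (discrete_topology Q)
  (fun q (x : wreath * wreath) => x.2.1 (to i q)) _ _ c12).
by move=> q; exact: (comp_continuous c2 (@wreath_base_continuous _)).
Qed.

Lemma wreath_invg_continuous : continuous (fun x : wreath => x^-1).
Proof.
apply: wreath_continuous => [i|]; last first.
  exact: (inv_fun_continuous wreath_top_continuous).
apply: inv_fun_continuous.
apply: (@eval_continuous _ _ (discrete_topology Q)
  (fun q (x : wreath) => x.1 (to i q^-1)) _ _ wreath_top_continuous).
by move=> q; exact: wreath_base_continuous.
Qed.

HB.instance Definition _ := isTopologicalGroup.Build wreath
  wreath_mulg_continuous wreath_invg_continuous.

End Wreath.

(** * Varieties and finite images of pro-C groups *)

Lemma hom_image_group (G : groupType) (gT : finGroupType) (f : G -> gT) :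
    {morph f : x y / x * y} ->
  exists A : {group gT}, forall y, y \in A <-> exists x, f x = y.
Proof.
move=> fM; pose A := finset (fun y : gT => `[<exists x, f x = y>]).
have AE y : y \in A <-> exists x, f x = y.
  by rewrite inE; split => [/asboolP|?]; last exact/asboolP.
have gA : group_set A.
  apply/group_setP; split => [|_ _ /AE[x <-] /AE[y <-]]; apply/AE.
    by exists 1; exact: morph1.
  by exists (x * y); rewrite fM.
by exists (Group gA).
Qed.

Section Varieties.
Context (C : forall gT : finGroupType, {group gT} -> Prop).
Hypothesis varC : is_extension_closed_variety C.

Lemma variety_trivial (gT : finGroupType) : C [1 gT]%G.
Proof.
have [[[hT [A CA]] sub _ hom] _] := varC.
have := hom hT gT A (trivm A) CA; congr (@C gT _).
by apply/group_inj; rewrite /= morphim_trivm.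
Qed.

Lemma variety_subg (gT : finGroupType) (A : {group gT}) :
  C A -> C [set: subg_of A]%G.
Proof.
have [[_ _ _ hom] _] := varC => CA.
have := hom _ _ _ (subg_morphism A) CA; congr (@C _ _).
by apply/group_inj; rewrite /= im_subg.
Qed.

(** [A <*> B] is an extension of [B] by a quotient of [A]. *)
Lemma variety_join (gT : finGroupType) (A B : {group gT}) :
  A \subset 'N(B) -> C A -> C B -> C (A <*> B)%G.
Proof.
have [[_ _ _ hom] ext] := varC.
move=> nBA CA CB; apply: (ext gT _ B) => //.
  by rewrite /normal joing_subr join_subG nBA normG.
have := hom _ _ A (restrm nBA (coset B)) CA; congr (@C _ _).
apply/group_inj; rewrite /= morphim_restrm.
by rewrite norm_joinEl // quotientMidr finset.setIid.
Qed.

Lemma pro_group_hom_image (G : topologicalGroupType) (gT : finGroupType)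
    (f : G -> gT) :
    pro_group C G -> continuous (f : G -> discrete_topology gT) ->
    {morph f : x y / x * y} ->
  exists A : {group gT}, C A /\ forall y, y \in A <-> exists x, f x = y.
Proof.
move=> [_ proG] cf fM; have [A AE] := hom_image_group fM.
exists A; split => //.
have fA x : f x \in A by apply/AE; exists x.
pose f' x := subg A (f x).
have f'K x : sgval (f' x) = f x by rewrite subgK.
have [_ _ _ hom] := varC.1.
have := hom _ gT [set: subg_of A]%G (sgval_morphism _).
rewrite (_ : (_ @* _)%G = A); last first.
  by apply/group_inj; rewrite /= im_sgval.
apply.
apply: (proG _ f') => [|x y|y].
- apply: (@comp_continuous G (discrete_topology gT) (discrete_topology _)
    f (subg A)) => //.
  exact: discrete_continuous.
- by apply: val_inj; rewrite /= !f'K fM.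
- have /AE[x fx] := subgP y; exists x.
  by apply: val_inj; rewrite /= f'K.
Qed.

End Varieties.

(** * Profinite spaces *)

Lemma injective_hausdorff (T U : topologicalType) (f : T -> U) :
  continuous f -> injective f -> hausdorff_space U -> hausdorff_space T.
Proof.
move=> cf fI hU x y clxy; apply: fI; apply: hU => A B Ax By.
by have [z [Az Bz]] := clxy _ _ (cf _ _ Ax) (cf _ _ By); exists (f z).
Qed.

Lemma injective_totally_disconnected (T U : topologicalType) (f : T -> U) :
    continuous f -> injective f ->
  totally_disconnected [set: U] -> totally_disconnected [set: T].
Proof.
move=> cf fI dU x _; rewrite eqEsubset; split => [y|_ ->]; last first.
  exact: connected_component_refl.
move=> [A [Ax _ cA] Ay]; apply: fI.
have : connected_component [set: U] (f x) (f y).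
  exists (f @` A); last by exists y.
  split; [by exists x | by [] | ].
  by apply: connected_continuous_connected => //; exact: continuous_subspaceT.
by rewrite dU.
Qed.

Lemma initial_compact (S : choiceType) (T : topologicalType) (f : S -> T) :
  compact (range f) -> compact [set: initial_topology f].
Proof.
move=> cf F PF _.
have FT : (f @ F) (range f) by apply: (@filterE _ F) => x; exists x.
have [_ [[s _ <-] Fs]] := cf (f @ F) _ FT; exists s; split => //.
move=> A B FA [_ [[V oV <-] Vs] sVB].
have FfA : (f @ F) (f @` A) by apply: (@filterS _ F _ A) => // a Aa; exists a.
have [_ [[a Aa <-] Va]] := Fs _ V FfA (open_nbhs_nbhs (conj oV Vs)).
by exists a; split => //; exact: sVB.
Qed.

Lemma profinite_initial (S : choiceType) (T : topologicalType) (f : S -> T) :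
    injective f -> compact (range f) -> hausdorff_space T ->
    totally_disconnected [set: T] ->
  profinite_space (initial_topology f).
Proof.
move=> fI cf hT dT; have ci := @initial_continuous S T f; split.
- exact: initial_compact.
- exact: (injective_hausdorff ci fI).
- exact: (injective_totally_disconnected ci fI).
Qed.

Lemma profinite_discrete (T : finType) : profinite_space (discrete_topology T).
Proof.
split; first by apply: finite_compact; exact: finite_finset.
- exact: discrete_hausdorff.
- exact/zero_dimension_totally_disconnected/discrete_zero_dimension.
Qed.

Lemma profinite_prod (T U : topologicalType) :
  profinite_space T -> profinite_space U -> profinite_space (T * U)%type.
Proof.
move=> [kT hT dT] [kU hU dU]; split.
- by rewrite -setXTT; exact: compact_setX.
- move=> [x1 x2] [y1 y2] cl; congr pair.
    apply: hT => A B Ax By.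
    have [[z _] [/= Az Bz]] := cl (fst @^-1` A) (fst @^-1` B)
      (@fst_continuous _ _ (x1, x2) _ Ax) (@fst_continuous _ _ (y1, y2) _ By).
    by exists z.
  apply: hU => A B Ax By.
  have [[_ z] [/= Az Bz]] := cl (snd @^-1` A) (snd @^-1` B)
    (@snd_continuous _ _ (x1, x2) _ Ax) (@snd_continuous _ _ (y1, y2) _ By).
  by exists z.
- move=> [x1 x2] _; rewrite eqEsubset; split => [[y1 y2]|_ ->]; last first.
    exact: connected_component_refl.
  move=> [A [Ax _ cA] Ay].
  have cimg (V : topologicalType) (f : T * U -> V) : continuous f ->
      connected_component [set: V] (f (x1, x2)) (f (y1, y2)).
    move=> cf; exists (f @` A); last by exists (y1, y2).
    split; [by exists (x1, x2) | by [] | ].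
    by apply: connected_continuous_connected => //; exact: continuous_subspaceT.
  have := cimg _ _ (@fst_continuous T U); rewrite dT //= => ->.
  by have := cimg _ _ (@snd_continuous T U); rewrite dU //= => ->.
Qed.

Lemma profinite_prod_topology (I : choiceType) (T : I -> topologicalType) :
  (forall i, profinite_space (T i)) -> profinite_space (prod_topology T).
Proof.
move=> pT; split.
- have := @tychonoff I T (fun=> setT); rewrite (_ : [set f | _] = setT).
    by apply => i; have [] := pT i.
  by apply/seteqP; split.
- by apply: hausdorff_product => i; have [] := pT i.
- have := @totally_disconnected_prod I T (fun=> setT).
  rewrite (_ : (fun f => _) = setT); last by apply/seteqP; split.
  by apply => i; have [] := pT i.
Qed.

(** * The wreath product of a pro-C group by a finite group is pro-C *)

Section ProGroups.
Context (C : forall gT : finGroupType, {group gT} -> Prop).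
Hypothesis varC : is_extension_closed_variety C.

Lemma pro_group_discrete (Q : finGroupType) :
  C [set: Q]%G -> pro_group C (discrete_topology Q).
Proof.
move=> CQ; split; first exact: profinite_discrete.
move=> gT f _ fM fsurj.
have fMQ : {in [set: Q]%G &, {morph f : x y / x * y}}.
  by move=> x y _ _; exact: fM.
have [_ _ _ hom] := varC.1.
have := hom _ _ _ (Morphism fMQ) CQ; congr (@C _ _); apply/group_inj => /=.
apply/setP => y; rewrite inE; have [x <-] := fsurj y.
by apply/morphimP; exists x; rewrite ?inE.
Qed.

Context (K : topologicalGroupType) (Q : finGroupType) (I : finType).
Context (to : {action Q &-> I}).
Local Notation W := (wreath_type K to).

Definition wreath_coord (i : I) (k : K) : W :=
  (fun j => if j == i then k else 1, 1).
Definition wreath_lift (q : discrete_topology Q) : W := (fun=> 1, q).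

Lemma wreath_coord_continuous i : continuous (wreath_coord i).
Proof.
apply: wreath_continuous => [j|] /=; last exact: cst_continuous.
by case: eqP => _ x; [exact: cvg_id | exact: cst_continuous].
Qed.

Lemma wreath_coordM i : {morph wreath_coord i : x y / x * y}.
Proof.
move=> x y; apply: wreath_eq => [j|] /=; last by rewrite mulg1.
by rewrite act1; case: eqP; rewrite ?mulg1.
Qed.

Lemma wreath_liftM : {morph wreath_lift : p q / p * q}.
Proof. by move=> p q; apply: wreath_eq => [j|] //=; rewrite mulg1. Qed.

Lemma wreath_coordC i j x y : i != j ->
  wreath_coord i x * wreath_coord j y = wreath_coord j y * wreath_coord i x.
Proof.
move=> ij; apply: wreath_eq => [k|] //=; rewrite act1.
have [-> /=|_] := eqVneq k i; last by rewrite mulg1 mul1g.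
by rewrite (negbTE ij) mulg1 mul1g.
Qed.

Lemma wreath_coordJ i x q :
  wreath_coord i x * wreath_lift q = wreath_lift q * wreath_coord (to i q) x.
Proof.
apply: wreath_eq => [j|] /=; last by rewrite mulg1 mul1g.
by rewrite mulg1 mul1g (inj_eq (act_inj to q)).
Qed.

(** A finite quotient of the wreath product is generated by the images [A i] of
the copies of [K], which are finite quotients of [K] and centralize each other,
and by the image [B] of [Q], which permutes them. Hence it is obtained from
groups of the variety by finitely many joins with a normalizing subgroup. *)
Lemma pro_group_wreath : pro_group C K -> C [set: Q]%G -> pro_group C W.
Proof.
move=> proK CQ; split.
  apply: profinite_prod (profinite_discrete Q).
  by apply: profinite_prod_topology => _; case: proK.
move=> gT f cf fM fsurj.
have imC i : exists A : {group gT}, C A /\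
    forall y, y \in A <-> exists k, f (wreath_coord i k) = y.
  apply: (pro_group_hom_image varC proK (f := f \o wreath_coord i)).
    exact: (@comp_continuous K W (discrete_topology gT) _ _
      (@wreath_coord_continuous i) cf).
  by move=> x y /=; rewrite wreath_coordM fM.
have [A /all_and2[CA AE]] := choice imC.
have [B [CB BE]] : exists B : {group gT}, C B /\
    forall y, y \in B <-> exists q, f (wreath_lift q) = y.
  apply: (pro_group_hom_image varC (pro_group_discrete CQ)
    (f := f \o wreath_lift)).
    exact: discrete_continuous.
  by move=> x y /=; rewrite wreath_liftM fM.
have AN i j : A i \subset 'N(A j).
  have [<-|ij] := eqVneq i j; first exact: normG.
  apply/cents_norm/centsP => _ /AE[x <-] _ /AE[y <-].
  by rewrite /commute -!fM wreath_coordC.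
pose N := (\prod_(i in I) A i)%G.
have NE : N :=: <<(\bigcup_(i in I) A i)%SET>> by exact: bigprodGE.
have sAN i : A i \subset N by rewrite NE sub_gen // (finset.bigcup_sup i).
have [CN ANN] : C N /\ forall j, A j \subset 'N(N).
  rewrite /N; elim/big_rec: _ => [|i M _ [CM nM]].
    by split => [|j]; [exact: variety_trivial | exact: norms1].
  by split => [|j]; [exact: (variety_join varC) | exact: normsY].
have BN : B \subset 'N(N).
  apply/normsP => _ /BE[q <-]; apply/eqP.
  rewrite finset.eqEcard cardJg leqnn andbT {1}NE -genJ gen_subG.
  apply/fintype.subsetP => _ /imsetP[z /finset.bigcupP[i _ /AE[x <-]] ->].
  rewrite /conjg -fM wreath_coordJ fM mulKg.
  by apply: (fintype.subsetP (sAN (to i q))); apply/AE; exists x.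
(* An element of the base group is the product of its coordinates, taken here
   one index at a time. *)
have fN a : f (a, 1) \in N.
  suff fNs (s : seq I) : uniq s ->
      f (fun i => if i \in s then a i else 1, 1) \in N.
    have := fNs _ (enum_uniq I); congr (f (_, _) \in N).
    by apply/funext => i; rewrite mem_enum.
  elim: s => [_|i s IH /= /andP[is_ us]].
    by have := group1 N; rewrite -(morph1 fM).
  rewrite (_ : (_, _) = wreath_coord i (a i) *
      (fun j => if j \in s then a j else 1, 1) :> W).
    rewrite fM groupM ?IH //.
    by apply: (fintype.subsetP (sAN i)); apply/AE; exists (a i).
  apply: wreath_eq => [j|] /=; last by rewrite mulg1.
  rewrite act1 in_cons; have [->|_] := eqVneq j i; last by rewrite mul1g.
  by rewrite (negbTE is_) mulg1.
have := variety_join varC BN CB CN; congr (@C _ _); apply/group_inj.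
apply/setP => y; rewrite /= [RHS]inE; have [[a q] <-] := fsurj y.
have -> : (a, q) = wreath_lift q * ((fun i => a (to i q^-1)), 1) :> W.
  by apply: wreath_eq => [j|] /=; rewrite ?mul1g ?actK ?mulg1.
by rewrite fM norm_joinEl // mem_mulg //; apply/BE; exists q.
Qed.

End ProGroups.

(** * The action on the cosets of an open subgroup *)

Definition finite_action (F : topologicalGroupType) (S : finType)
    (act : S -> F -> S) : Prop :=
  [/\ forall s, act s 1 = s, forall s g h, act s (g * h) = act (act s g) h &
      forall s, continuous (act s : F -> discrete_topology S)].

Lemma finite_action_perm (F : topologicalGroupType) (S : finType)
    (act : S -> F -> S) :
    finite_action act ->
  exists rho : F -> {perm S},
    [/\ continuous (rho : F -> discrete_topology {perm S}),
        {morph rho : g h / g * h} & forall g s, rho g s = act s g].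
Proof.
move=> [act1 actM actc].
have actI g : injective (act^~ g).
  by apply: (can_inj (g := act^~ g^-1)) => s; rewrite -actM mulgV.
pose rho g : {perm S} := perm (actI g).
have rhoE g s : rho g s = act s g by rewrite permE.
exists rho; split => // [g|g h]; last first.
  by apply/permP => s; rewrite permM !rhoE actM.
move=> U /principal_filterP Ug.
have : \forall h \near g, forall s, act s h = act s g.
  apply: filter_forall => s.
  by have := actc s g _ (discrete_set1 (act s g : discrete_topology S)).
apply: filterS => h hE.
suff hg : rho h = rho g by move: Ug; rewrite -hg.
by apply/permP => s; rewrite !rhoE.
Qed.

(** Finitely many cosets [H g] cover [F] by compactness; sending [x] to the
first element [e x] of a finite list of representatives with [x \in H (e x)]
gives each coset a canonical representative, and the points of [S] are these. *)
Lemma coset_action (F : topologicalGroupType) (H : groupClosed F) :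
    compact [set: F] -> open [set x : F | x \in H] ->
  exists (S : finType) (act : S -> F -> S) (s0 : S),
    [/\ finite_action act, forall g, act s0 g = s0 <-> g \in H &
        forall s, exists g, act s0 g = s].
Proof.
move=> kF oH.
have oHt (a b : F) : open [set x | a * x * b \in H].
  have cab : continuous (fun x : F => a * x * b).
    by apply: mul_fun_continuous; [apply: mul_fun_continuous|] => // x;
      [exact: cst_continuous | exact: cvg_id | exact: cst_continuous].
  by move/continuousP: cab => /(_ _ oH).
pose Fp : ptopologicalType :=
  HB.pack (Topological.sort F) (isPointed.Build (Topological.sort F) 1).
have kFp : @cover_compact Fp [set: Fp] by rewrite -compact_cover.
have [D Dcov] : exists D : seq F, forall x, exists2 d, d \in D & x * d^-1 \in H.
  have [||D _ Dcov] := kFp F setT (fun g => [set x | 1 * x * g^-1 \in H]).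
  - by move=> g _; exact: oHt.
  - by move=> x _; exists x => //=; rewrite mul1g mulgV gpred1.
  exists (finmap.enum_fset D) => x.
  by have [d /= dD] := Dcov x I; rewrite mul1g; exists d.
pose e x := head 1 [seq d <- D | x * d^-1 \in H].
have eP x : e x \in D /\ x * (e x)^-1 \in H.
  have [d dD xd] := Dcov x.
  have : d \in [seq d <- D | x * d^-1 \in H] by rewrite mem_filter xd.
  rewrite /e; case E: [seq d <- D | x * d^-1 \in H] => [//|c l] _ /=.
  have : c \in [seq d <- D | x * d^-1 \in H] by rewrite E mem_head.
  by rewrite mem_filter => /andP[].
have eE x y : e x = e y <-> x * y^-1 \in H.
  split => [exy|xy].
    have [_ xH] := eP x; have [_] := eP y; rewrite -exy => yH.
    have -> : x * y^-1 = (x * (e x)^-1) * (y * (e x)^-1)^-1.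
      by rewrite invgM invgK mulgA mulgKV.
    exact: gpredF.
  rewrite /e; congr head; apply: eq_filter => d /=.
  have -> : x * d^-1 = (x * y^-1) * (y * d^-1) by rewrite mulgA mulgKV.
  by rewrite gpredMl.
pose S : finType := seq_sub [seq e d | d <- D].
have cls_subproof x : e x \in [seq e d | d <- D].
  apply/mapP; exists (e x); first by case: (eP x).
  by apply/eE; case: (eP x).
pose cls x : S := SeqSub (cls_subproof x).
have clsE x y : cls x = cls y <-> x * y^-1 \in H.
  rewrite -eE; split => [/(congr1 val)//|exy]; exact: val_inj.
have clsK (s : S) : cls (ssval s) = s.
  have /mapP[d _ sd] := valP s.
  apply: val_inj; rewrite /= sd; apply/eE.
  by rewrite -(gpredV H) invgM invgK; case: (eP d).
pose act (s : S) g := cls (ssval s * g).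
have actE x g : act (cls x) g = cls (x * g).
  apply/clsE; rewrite invgM mulgA mulgK -(gpredV H) invgM invgK.
  by case: (eP x).
exists S, act, (cls 1); split.
- split => [s|s g h|s g].
  + by rewrite /act mulg1 clsK.
  + by rewrite [act s g]/act actE /act mulgA.
  + move=> U /principal_filterP Ug.
    have : nbhs g [set x | ssval s * x * (ssval s * g)^-1 \in H].
      by apply: open_nbhs_nbhs; split; [exact: oHt | rewrite /= mulgV gpred1].
    apply: filterS => x /= /clsE xg.
    by move: Ug; rewrite /act -xg.
- by move=> g; rewrite actE mul1g clsE invg1 mulg1.
- by move=> s; exists (ssval s); rewrite actE mul1g clsK.
Qed.

(** * The Schreier cocycle of a transversal *)

Section SchreierCocycle.
Context (F : topologicalGroupType) (H : groupClosed F).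
Context (S : finType) (act : S -> F -> S) (s0 : S).
Hypothesis act_finite : finite_action act.
Hypothesis act_stab : forall g, act s0 g = s0 <-> g \in H.

Lemma coset_set_closed : closed [set x : F | x \in H].
Proof.
have [_ _ actc] := act_finite.
rewrite (_ : [set x | _] = act s0 @^-1` [set s0]); last first.
  by apply/seteqP; split => g /= /act_stab.
apply: (@preimage_closed F (discrete_topology S)) => [g _|]; first exact: actc.
exact: discrete_closed.
Qed.

Lemma profinite_open_subgroup :
  profinite_space F -> profinite_space (subgroup_type H).
Proof.
move=> [kF hF dF].
apply: (@profinite_initial (subgroup_type H) F val val_inj) => //.
apply: (subclosed_compact _ kF) => //.
rewrite (_ : range _ = [set x : F | x \in H]); first exact: coset_set_closed.
apply/seteqP; split => [_ [h _ <-]|x xH] /=; first exact: valP.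
by exists (Sub x xH : subgroup_type H) => //; rewrite SubK.
Qed.

Context (t : S -> F).
Hypothesis t_act : forall s, act s0 (t s) = s.

(** The value always lies in [H] ([val_schreier]); the default [1] of [insubd]
is never taken. *)
Definition schreier s g : subgroup_type H :=
  insubd (1 : subgroup_type H) (t s * g * (t (act s g))^-1).

Lemma val_schreier s g : val (schreier s g) = t s * g * (t (act s g))^-1.
Proof.
have [act1 actM _] := act_finite.
rewrite insubdK //; apply/act_stab.
have := actM s0 (t (act s g)) (t (act s g))^-1; rewrite mulgV act1 t_act.
by rewrite !actM t_act.
Qed.

Lemma schreierM s g h :
  schreier s (g * h) = schreier s g * schreier (act s g) h.
Proof.
have [_ actM _] := act_finite.
apply: val_inj; rewrite [RHS]valM !val_schreier -actM.
by rewrite !mulgA mulgKV.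
Qed.

Lemma schreier_continuous s : continuous (schreier s).
Proof.
have [_ _ actc] := act_finite.
apply: continuous_comp_initial.
rewrite (_ : _ \o _ = fun g => t s * g * (t (act s g))^-1); last first.
  by apply/funext => g; exact: val_schreier.
apply: mul_fun_continuous.
  by apply: mul_fun_continuous => x; [exact: cst_continuous | exact: cvg_id].
apply: (@comp_continuous F (discrete_topology S) F
  (act s) (fun s => (t s)^-1)) => //.
exact: discrete_continuous.
Qed.

Lemma schreier_base (h : subgroup_type H) : t s0 = 1 -> schreier s0 (val h) = h.
Proof.
move=> t1; apply: val_inj; rewrite val_schreier.
by rewrite (act_stab (val h)).2 ?t1 ?invg1 ?mulg1 ?mul1g //; exact: valP.
Qed.

End SchreierCocycle.

(** Finite quotients of [H] come from finite quotients of [F] by induction of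
actions: a continuous homomorphism [f] from [H] to a finite group [gT] makes [F]
act on [S * gT] through the cocycle [f (schreier s g)]. The image of [H] in the
permutations of [S * gT] is a subgroup of that of [F], hence in the variety, and
[f] factors through it: [f h] is read off the action of [h] on [(s0, 1)]. *)
Lemma pro_group_open_subgroup
    (C : forall gT : finGroupType, {group gT} -> Prop)
    (F : topologicalGroupType) (H : groupClosed F) :
    is_extension_closed_variety C -> pro_group C F ->
    open [set x : F | x \in H] ->
  pro_group C (subgroup_type H).
Proof.
move=> varC proF oH; have [pF _] := proF; have [kF _ _] := pF.
have [S [act [s0 [actF stab /choice[u uE]]]]] := coset_action kF oH.
split; first exact: (profinite_open_subgroup actF stab).
move=> gT f cf fM fsurj.
have [act1 actM actc] := actF.
pose t s := if s == s0 then 1 else u s.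
have tE s : act s0 (t s) = s by rewrite /t; case: eqP => // ->.
have t1 : t s0 = 1 by rewrite /t eqxx.
pose c := schreier H act t.
have cM s g h : c s (g * h) = c s g * c (act s g) h.
  exact: (schreierM actF stab tE).
have c1 s : c s 1 = 1.
  by apply: (mulgI (c s 1)); rewrite -{2}(act1 s) -cM !mulg1.
have f1 := morph1 fM.
pose act2 (x : S * gT) g := (act x.1 g, x.2 * f (c x.1 g)).
have act2F : finite_action act2.
  split => [[s y]|[s y] g h|[s y]].
  - by rewrite /act2 /= act1 c1 f1 mulg1.
  - by rewrite /act2 /= actM cM fM mulgA.
  - move=> g U /principal_filterP Ug.
    have nact : nbhs g [set h | act s h = act s g].
      exact: (actc s g _ (discrete_set1 (act s g : discrete_topology S))).
    have ncf : nbhs g [set h | f (c s h) = f (c s g)].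
      have cc : continuous (c s) by apply: (schreier_continuous actF stab tE).
      exact: cc (cf _ _ (discrete_set1 (f (c s g) : discrete_topology gT))).
    apply: filterS (filterI nact ncf) => h [/= ah fh].
    by move: Ug; rewrite /act2 /= -ah -fh.
have [rho [crho rhoM rhoE]] := finite_action_perm act2F.
have [A [CA AE]] := pro_group_hom_image varC proF crho rhoM.
have [B BE] := @hom_image_group (subgroup_type H) _ (fun h => rho (val h))
  (fun x y => rhoM (val x) (val y)).
have CB : C _ B.
  have [_ sub _ _] := varC.1; apply: sub CA.
  by apply/fintype.subsetP => _ /BE[h <-]; apply/AE; exists (val h).
pose b (p : {perm S * gT}) := (p (s0, 1)).2.
have bE h : b (rho (val h)) = f h.
  by rewrite /b rhoE /act2 /= mul1g /c (schreier_base actF stab tE).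
have bM : {in B &, {morph b : x y / x * y}}.
  move=> _ _ /BE[x <-] /BE[y <-].
  by rewrite -rhoM -[val x * val y]/(val (x * y)) !bE fM.
have [_ _ _ hom] := varC.1.
have := hom _ _ _ (Morphism bM) CB; congr (@C _ _); apply/group_inj => /=.
apply/setP => y; rewrite inE; have [h <-] := fsurj y.
apply/morphimP; exists (rho (val h)); rewrite ?bE //; apply/BE; exists h => //.
Qed.

(** * Free pro-C groups acting on finite sets *)

Lemma connect_distance (S : finType) (e : rel S) (s0 : S) :
    (forall s, connect e s0 s) ->
  exists dist : S -> nat, dist s0 = 0 /\ forall s, s != s0 ->
    exists2 p, e p s & dist s = (dist p).+1.
Proof.
move=> conn.
pose reach s n := `[<exists q, [/\ path e s0 q, last s0 q = s & size q = n]>].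
have reachP s : exists n, reach s n.
  have /connectP[q eq ->] := conn s.
  by exists (size q); apply/asboolP; exists q.
pose dist s := ex_minn (reachP s).
have distP s : exists q, [/\ path e s0 q, last s0 q = s & size q = dist s].
  by rewrite /dist; case: ex_minnP => n /asboolP.
have dist_min s q : path e s0 q -> last s0 q = s -> dist s <= size q.
  move=> eq sq; rewrite /dist; case: ex_minnP => n _; apply.
  by apply/asboolP; exists q.
exists dist; split => [|s ss0].
  by apply/eqP; rewrite -leqn0; exact: (dist_min _ [::]).
have [q] := distP s; case/lastP: q => [[_ /= s0s]|q s' []].
  by rewrite s0s eqxx in ss0.
rewrite rcons_path last_rcons size_rcons => /andP[eq es] s's dE.
rewrite {s'}s's in es; exists (last s0 q) => //; apply/eqP.
rewrite eqn_leq -{2}dE ltnS (dist_min _ q) // andbT.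
have [q' [eq' lq' <-]] := distP (last s0 q).
rewrite -(size_rcons q' s); apply: dist_min; last by rewrite last_rcons.
by rewrite rcons_path eq' lq'.
Qed.

Definition perm_subg_act (S : finType) (A : {group {perm S}}) (s : S)
  (a : subg_of A) : S := sgval a s.

Lemma perm_subg_act_is_action (S : finType) (A : {group {perm S}}) :
  is_action [set: subg_of A]%G (@perm_subg_act S A).
Proof.
split => [a s s'|s a b _ _]; first exact: perm_inj.
by rewrite /perm_subg_act permM.
Qed.

Canonical perm_subg_action (S : finType) (A : {group {perm S}}) :=
  Action (@perm_subg_act_is_action S A).

(** Only positive letters are used: as [S] is finite, inverses of letters do not
reach further points. *)
Definition letter_step (X F : Type) (S : finType) (iota : X -> F)
    (act : S -> F -> S) : rel S :=
  fun s s' => `[<exists x, act s (iota x) = s'>].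

Section FreeGroups.
Context (C : forall gT : finGroupType, {group gT} -> Prop).
Hypothesis varC : is_extension_closed_variety C.
Context (X : topologicalType) (x0 : X) (F : topologicalGroupType).
Context (iota : X -> F).
Hypotheses (proF : pro_group C F) (iota_cont : continuous iota).
Hypothesis iota_pointed : iota x0 = 1.
Hypothesis iota_free :
  forall (G : topologicalGroupType) (sigma : X -> G),
    pro_group C G -> continuous sigma -> sigma x0 = 1 ->
    exists! psi : F -> G, continuous_hom psi /\ psi \o iota = sigma.

Lemma free_hom_eq (G : topologicalGroupType) (f g : F -> G) :
    pro_group C G -> continuous_hom f -> continuous_hom g ->
    (forall x, f (iota x) = g (iota x)) ->
  f = g.
Proof.
move=> proG hf hg fg.
have cf := comp_continuous iota_cont hf.1.
have f1 : (f \o iota) x0 = 1 by rewrite /= iota_pointed (morph1 hf.2).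
have [psi [_ uniq]] := @iota_free G (f \o iota) proG cf f1.
have gf : g \o iota = f \o iota by apply/funext => x /=.
by rewrite -(uniq f) // -(uniq g).
Qed.

Context (S : finType) (act : S -> F -> S).
Hypothesis act_finite : finite_action act.

Lemma finite_action_image : exists (A : {group {perm S}}) (q : F -> subg_of A),
  [/\ C A, C [set: subg_of A]%G,
      continuous_hom (q : F -> discrete_topology (subg_of A)) &
      forall g s, sgval (q g) s = act s g].
Proof.
have [rho [crho rhoM rhoE]] := finite_action_perm act_finite.
have [A [CA AE]] := pro_group_hom_image varC proF crho rhoM.
have rhoK g : sgval (subg A (rho g)) = rho g by apply/subgK/AE; exists g.
exists A, (fun g => subg A (rho g)); split => //.
- exact: variety_subg.
- split; last by move=> g h; apply: val_inj; rewrite /= !rhoK rhoM.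
  apply: (@comp_continuous F (discrete_topology {perm S})
    (discrete_topology (subg_of A)) rho (subg A)) => //.
  exact: discrete_continuous.
- by move=> g s; rewrite rhoK.
Qed.

(** The permutations in the image of [F] that preserve the set of points reached
from [s] form a group [B] of the variety. It contains the images of the letters,
so these extend to a homomorphism from [F] to [B], which must be the action. *)
Lemma free_action_connect s g : connect (letter_step iota act) s (act s g).
Proof.
have [A [q [CA CQ hq qE]]] := finite_action_image.
pose e := letter_step iota act.
pose B := finset (fun a =>
  (a \in A) && [forall s', connect e s s' ==> connect e s (a s')]).
have gB : group_set B.
  apply/group_setP; split => [|a b].
    by rewrite inE group1; apply/forallP => s'; rewrite perm1 implybb.
  rewrite !inE => /andP[Aa /forallP sa] /andP[Ab /forallP sb].
  rewrite groupM //=; apply/forallP => s'; apply/implyP => /(implyP (sa _)).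
  by rewrite permM; exact/implyP.
have iB x : sgval (q (iota x)) \in Group gB.
  rewrite inE subgP; apply/forallP => s'; apply/implyP => ss'.
  rewrite qE; apply: connect_trans ss' _; apply: connect1.
  by apply/asboolP; exists x.
have sBA : B \subset A by apply/fintype.subsetP => a; rewrite inE => /andP[].
have CB : C (Group gB) by have [_ sub _ _] := varC.1; exact: sub CA.
have CB' := variety_subg varC CB.
have [||psi [[[cpsi psiM] psiE] _]] := @iota_free
    (discrete_topology (subg_of (Group gB)))
    (fun x => subg (Group gB) (sgval (q (iota x))))
    (pro_group_discrete varC CB').
- apply: (@comp_continuous X (discrete_topology (subg_of A))
    (discrete_topology _) (q \o iota) (fun a => subg (Group gB) (sgval a)));
    last exact: discrete_continuous.
  by apply: comp_continuous => //; case: hq.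
- by rewrite iota_pointed (morph1 hq.2); apply: val_inj; rewrite /= subgK.
have psiA h : sgval (psi h) \in A by apply: (fintype.subsetP sBA); exact: subgP.
have qpsi : q = (fun h => subg A (sgval (psi h))).
  apply: (@free_hom_eq (discrete_topology (subg_of A))) => //.
  - exact: pro_group_discrete.
  - split.
      apply: (@comp_continuous F (discrete_topology (subg_of (Group gB)))
        (discrete_topology _) psi (fun a => subg A (sgval a))) => //.
      exact: discrete_continuous.
    by move=> h k; apply: val_inj; rewrite /= !subgK // psiM.
  - move=> x; apply: val_inj; rewrite /= subgK //.
    by have /(congr1 (fun k => k x)) /= -> := psiE; rewrite subgK.
have : sgval (psi g) \in Group gB by exact: subgP.
rewrite inE => /andP[_ /forallP/(_ s)]; rewrite connect0 /=.
suff -> : sgval (psi g) s = act s g by [].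
by rewrite -qE qpsi subgK.
Qed.

Definition cocycle (K : topologicalGroupType) (c : S -> F -> K) : Prop :=
  (forall s, continuous (c s)) /\
  (forall s g h, c s (g * h) = c s g * c (act s g) h).

(** Values [tau s x] and the action prescribe a map from [X] to the wreath
product; the base coordinates of its extension to [F] form the cocycle, once the
top coordinate is recognized as the action by uniqueness. *)
Lemma free_cocycle_exists (K : topologicalGroupType) (tau : S -> X -> K) :
    pro_group C K -> (forall s, continuous (tau s)) ->
    (forall s, tau s x0 = 1) ->
  exists2 c, cocycle c & forall s x, c s (iota x) = tau s x.
Proof.
move=> proK ctau tau1.
have [A [q [_ CQ hq qE]]] := finite_action_image.
pose W : topologicalGroupType := wreath_type K (perm_subg_action A).
have proW : pro_group C W by exact: pro_group_wreath.
have [||psi [[[cpsi psiM] psiE] _]] :=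
    @iota_free W (fun x => (tau^~ x, q (iota x))) proW.
- apply: wreath_continuous => /=; first exact: ctau.
  exact: (comp_continuous iota_cont hq.1).
- apply: wreath_eq => [s|] /=; first exact: tau1.
  by rewrite iota_pointed (morph1 hq.2).
have psiq : (fun g => (psi g).2) = q.
  apply: (@free_hom_eq (discrete_topology (subg_of A))) => //.
  - exact: pro_group_discrete.
  - split; last by move=> g h; rewrite psiM.
    exact: (comp_continuous cpsi (@wreath_top_continuous _ _ _ _)).
  - by move=> x; have /(congr1 (fun k => k x)) /= -> := psiE.
exists (fun s g => (psi g).1 s); last first.
  by move=> s x; have /(congr1 (fun k => k x)) /= -> := psiE.
split => [s|s g h].
  exact: (comp_continuous cpsi (@wreath_base_continuous _ _ _ _ s)).
by rewrite psiM /= -[in RHS]qE -[in RHS]psiq.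
Qed.

Lemma free_cocycle_unique (K : topologicalGroupType) (c d : S -> F -> K) :
    pro_group C K -> cocycle c -> cocycle d ->
    (forall s x, c s (iota x) = d s (iota x)) ->
  c = d.
Proof.
move=> proK cc cd cdE.
have [A [q [_ CQ hq qE]]] := finite_action_image.
pose W : topologicalGroupType := wreath_type K (perm_subg_action A).
have proW : pro_group C W by exact: pro_group_wreath.
pose ind (c : S -> F -> K) (g : F) : W := (c^~ g, q g).
have indP c' : cocycle c' -> continuous_hom (ind c').
  move=> [cont c'M]; split.
    by apply: wreath_continuous => //=; exact: hq.1.
  move=> g h; apply: wreath_eq => [s|] /=; last exact: hq.2.
  by rewrite c'M -[in LHS]qE.
have E : ind c = ind d.
  apply: free_hom_eq (indP c cc) (indP d cd) _ => // x.
  by apply: wreath_eq => [s|] //=; rewrite cdE.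
apply/funext => s; apply/funext => g.
exact: (congr1 (fun k => (k g).1 s) E).
Qed.

End FreeGroups.

(** The last clause says that the equations [t (s x) = t s * iota x] hold along
the edges of a spanning tree rooted at [s0], in the form of the induction
principle on that tree. The tree joins each point to one that is a step nearer
to [s0]. *)
Lemma schreier_transversal (F : topologicalGroupType) (X : Type)
    (iota : X -> F) (S : finType) (act : S -> F -> S) (s0 : S) :
    finite_action act ->
    (forall s, connect (letter_step iota act) s0 s) ->
  exists t : S -> F,
    [/\ t s0 = 1, forall s, act s0 (t s) = s &
      forall P : S -> Prop, P s0 ->
        (forall s x, P s -> t (act s (iota x)) = t s * iota x ->
           P (act s (iota x))) -> forall s, P s].
Proof.
move=> [act1 actM _] /connect_distance[dist [dist0 distS]].
have /choice[pre preP] s : exists px : option (S * X), s != s0 ->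
    if px is Some (p, x) then act p (iota x) = s /\ dist s = (dist p).+1
    else False.
  have [|ss0] := eqVneq s s0; first by exists None.
  have [p /asboolP[x px] dp] := distS s ss0.
  by exists (Some (p, x)).
(* The word read on the branch of [s], cut after [n] letters; it is complete
   for [n = dist s]. *)
pose fix tt n s {struct n} := if n is n'.+1 then
  (if pre s is Some (p, x) then tt n' p * iota x else 1) else 1.
pose t s := tt (dist s) s.
have step s : s != s0 -> exists p x,
    [/\ act p (iota x) = s, dist s = (dist p).+1 & t s = t p * iota x].
  move=> /preP; rewrite /t; case E: (pre s) => [[p x]|//] [ps dp].
  by exists p, x; split => //; rewrite dp /= E.
have ind (P : S -> Prop) : P s0 ->
    (forall s x, P s -> t (act s (iota x)) = t s * iota x ->
      P (act s (iota x))) -> forall s, P s.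
  move=> P0 PS s; have [n] := ubnP (dist s); elim: n s => // n IH s.
  have [-> //|/step[p [x [<- -> tE]]]] := eqVneq s s0.
  by rewrite ltnS => dn; apply: PS (IH _ dn) tE.
have t1 : t s0 = 1 by rewrite /t dist0.
exists t; split => //; apply: ind => [|s x ts ->]; first by rewrite t1 act1.
by rewrite actM ts.
Qed.

(** * Open subgroups of free pro-C groups *)

Theorem theorem3p3p1
    (C : forall gT : finGroupType, {group gT} -> Prop)
    (X : topologicalType) (x0 : X)
    (F : topologicalGroupType) (H : groupClosed F) :
  is_extension_closed_variety C ->
  profinite_space X ->
  free_pro_group C X x0 F ->
  open [set x : F | x \in H] ->
  exists (Y : topologicalType) (y0 : Y),
    profinite_space Y /\ free_pro_group C Y y0 (subgroup_type H).
Proof.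
move=> varC pX [proF [iota [ciota iota1 free]]] oH.
have [[kF _ _] _] := proF.
have [S [act [s0 [actF stab trans]]]] := coset_action kF oH.
have conn s : connect (letter_step iota act) s0 s.
  have [g <-] := trans s.
  exact: (free_action_connect varC proF ciota iota1 free actF).
have [t [t1 tE tind]] := schreier_transversal actF conn.
have [act1 _ _] := actF.
pose c := schreier H act t.
have cval s g : val (c s g) = t s * g * (t (act s g))^-1 by exact: val_schreier.
have cc s : continuous (c s) by exact: (schreier_continuous actF stab tE).
pose gamma (z : discrete_topology S * X) : subgroup_type H := c z.1 (iota z.2).
have cgamma : continuous gamma.
  apply: (@eval_continuous _ _ (discrete_topology S)
    (fun s z => c s (iota z.2)) fst) => [s|].
    apply: (@comp_continuous _ F _ (iota \o snd)).
      exact: (comp_continuous (@snd_continuous _ _) ciota).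
    exact: cc.
  exact: fst_continuous.
have gamma1 s : gamma (s, x0) = 1.
  by apply: val_inj; rewrite cval iota1 act1 mulg1 mulgV.
have proH := pro_group_open_subgroup varC proF oH.
pose Y : topologicalType := set_type (range gamma).
have memY z : gamma z \in range gamma by apply/mem_set; exists z.
pose toY z : Y := exist _ (gamma z) (memY z).
have toYx0 s : toY (s, x0) = toY (s0, x0) by apply: val_inj; rewrite /= !gamma1.
have ctoY : continuous toY by exact: continuous_comp_initial.
exists Y, (toY (s0, x0)); split.
  have [[kH hH dH] _] := proH.
  apply: (@profinite_initial Y (subgroup_type H) set_val val_inj) => //.
  rewrite (_ : range _ = range gamma); last first.
    apply/seteqP; split => [_ [[y yP] _ <-]|y [z _ <-]]; first exact: set_mem.
    by exists (toY z).
  apply: continuous_compact; first exact: continuous_subspaceT.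
  by have [] := profinite_prod (profinite_discrete S) pX.
split=> //; exists set_val; split.
- exact: initial_continuous.
- exact: gamma1.
move=> K sigma proK csigma sigma1.
have ind_cocycle psi : continuous_hom psi ->
    cocycle act (fun s g => psi (c s g) : K).
  move=> [cpsi psiM]; split => [s|s g h].
    exact: (comp_continuous (cc s) cpsi).
  by rewrite /c (schreierM actF stab tE) psiM.
pose tau s x := sigma (toY (s, x)).
have ctau s : continuous (tau s).
  have cs : continuous (fun x : X => (s : discrete_topology S, x)).
    by apply: pair_continuous => x; [exact: cst_continuous | exact: cvg_id].
  exact: (comp_continuous (comp_continuous cs ctoY) csigma).
have tau1 s : tau s x0 = 1 by rewrite /tau toYx0.
have [d cocd dE] :=
  free_cocycle_exists varC proF ciota iota1 free actF proK ctau tau1.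
(* By induction along the tree, whose edges carry trivial generators. *)
have dt s : d s0 (t s) = 1.
  apply: (tind (fun s => d s0 (t s) = 1)) => [|{}s x ds tx].
    rewrite t1; apply: (mulgI (d s0 1)).
    by rewrite -{2}(act1 s0) -cocd.2 !mulg1.
  rewrite tx cocd.2 ds mul1g tE dE /tau.
  rewrite (_ : toY _ = toY (s0, x0)) //.
  by apply: val_inj; rewrite /= gamma1; apply: val_inj; rewrite cval tx mulgV.
have dH (h : subgroup_type H) g : d s0 (val h * g) = d s0 (val h) * d s0 g.
  by rewrite cocd.2 (stab _).2 //; exact: valP.
exists (fun h => d s0 (val h)); split.
  split.
    split; last by move=> h k; rewrite -dH.
    exact: (comp_continuous (@initial_continuous _ _ _) (cocd.1 s0)).
  apply/funext => y /=.
  have [[s x] _ zy] := set_mem (valP y).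
  have -> : y = toY (s, x) by apply: val_inj; rewrite /= zy.
  have gt : val (gamma (s, x)) * t (act s (iota x)) = t s * iota x.
    by rewrite cval mulgKV.
  have := dH (gamma (s, x)) (t (act s (iota x))).
  by rewrite gt cocd.2 !dt mul1g mulg1 tE dE set_valE.
move=> psi [hpsi psiE]; apply/funext => h.
have E : (fun s g => psi (c s g)) = d.
  apply: (free_cocycle_unique varC proF ciota iota1 free actF proK
    (ind_cocycle _ hpsi) cocd).
  by move=> s x; rewrite dE /tau -psiE /= set_valE.
by rewrite -E /c (schreier_base actF stab tE).
Qed.
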